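(* Let $n\ge 1$, let $u$ be a Bernstein function satisfying $u(t)\le Ct^{1/2}$ for all $t>0$ and some constant $C$. Then the function $a_u:\mathbb{R}^{2n+1}\to\mathbb{R}$ given by $a_u(\xi)=u(1+\|\xi\|^2)$ is an admissible negative definite function.
   Context: A Bernstein function is a smooth function $f:(0,\infty)\to\mathbb{R}$ with a continuous extension to $[0,\infty)$ such that $f\ge0$ and $(-1)^kf^{(k)}\le0$ for all integers $k\ge1$. A continuous negative definite function on $\mathbb{R}^{2n+1}$ is meant in the sense of Schoenberg: $\psi$ continuous such that $e^{-t\psi}$ is positive definite for all $t>0$. Write $\xi=(w,\lambda)\in\mathbb{R}^{2n}\times\mathbb{R}$ and $\rho(w,\lambda)=(1+\|w\|^2+|\lambda|^2)^{1/2}$. A positive function $m$ on $\mathbb{R}^{2n}\times\mathbb{R}$ is a weight for $\rho$ if there are $C>0$, $N\in\mathbb{N}$ such that for all $u,w\in\mathbb{R}^{2n}$, $\lambda\neq0$: (i) $\|u-w\|\le C^{-1}\rho(w,\lambda)\Rightarrow (m(w,\lambda)/m(u,\lambda))^{\pm1}\le C$; (ii) $(m(w,\lambda)/m(u,\lambda))^{\pm1}\le C(1+|\lambda|^{-1}\rho(w,\lambda)\|u-w\|)^N$. A continuous negative definite function $\psi$ on $\mathbb{R}^{2n+1}$ is admissible if (i) $\psi$ is real; (ii) $1+\psi$ is a weight for $\rho$ and $\psi\le C\rho$ for some $C$; (iii) $\psi$ is smooth and $|\partial_w^\alpha\partial_\lambda^\beta\psi(w,\lambda)|\le c_{\alpha,\beta}(1+\psi(w,\lambda))\rho(w,\lambda)^{-|\alpha|-\beta}$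 for all $\alpha\in\mathbb{N}^{2n},\beta\in\mathbb{N}$. *)

(* Defs.v *)
From HB Require Import structures.
From mathcomp Require Import all_boot all_order all_algebra.
From mathcomp Require Import complex.
From mathcomp Require Import all_classical all_reals all_analysis.

Set Implicit Arguments.
Unset Strict Implicit.
Unset Printing Implicit Defensive.

Import Order.TTheory GRing.Theory Num.Theory.
Import numFieldNormedType.Exports.

Local Open Scope classical_set_scope.
Local Open Scope complex_scope.
Local Open Scope ring_scope.

(* [f] is only meaningful on ]0, +oo[: its values at nonpositive arguments
   play no role below, since differentiability at x > 0 is a local property. *)
Definition bernstein {R : realType} (f : R -> R) : Prop :=
  [/\ forall (k : nat) (x : R), 0 < x -> derivable f^`(k)%classic x 1,
      exists g : R -> R,
        {within `[0, +oo[, continuous g} /\ (forall x, 0 < x -> g x = f x),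
      forall x : R, 0 < x -> 0 <= f x &
      forall (k : nat) (x : R), (1 <= k)%N -> 0 < x ->
        (-1) ^+ k * f^`(k)%classic x <= 0].

(* The library norm [`|x|] on ['rV[R]_d] is the maximum norm; it is used here
   only through the topology it induces. *)
Definition enorm {R : realType} {d : nat} (x : 'rV[R]_d) : R :=
  Num.sqrt (\sum_(i < d) x 0 i ^+ 2).

Definition cexp {R : realType} (z : R[i]) : R[i] :=
  (expR (complex.Re z))%:C *
  (cos (complex.Im z) +i* sin (complex.Im z)).

(* In the order of [R[i]], [0 <= z] says that z is real and nonnegative. *)
Definition positive_definite {R : realType} {d : nat}
    (phi : 'rV[R]_d -> R[i]) : Prop :=
  forall (N : nat) (x : 'I_N -> 'rV[R]_d) (c : 'I_N -> R[i]),
    0 <= \sum_(j < N) \sum_(k < N) phi (x j - x k) * c j * (c k)^*.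

Definition negative_definite {R : realType} {d : nat}
    (psi : 'rV[R]_d -> R[i]) : Prop :=
  [/\ continuous (fun x => complex.Re (psi x)),
      continuous (fun x => complex.Im (psi x)) &
      forall t : R, 0 < t ->
        positive_definite (fun x => cexp (- (t%:C * psi x)))].

Definition partial {R : realType} {d : nat} (i : 'I_d)
    (f : 'rV[R]_d -> R) : 'rV[R]_d -> R :=
  fun x => 'D_(delta_mx 0 i) f x.

(* All iterated partial derivatives, in any order, exist and are continuous;
   existence is asked separately because ['D] is a total operator. *)
Definition smooth {R : realType} {d : nat} (f : 'rV[R]_d -> R) : Prop :=
  forall s : seq 'I_d,
    continuous (foldr partial f s) /\
    (forall (i : 'I_d) (x : 'rV[R]_d),
       derivable (foldr partial f s) x (delta_mx 0 i)).

(* The point of R^(2n+1) with components (w, lambda). *)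
Definition pt {R : realType} {n : nat} (w : 'rV[R]_(2 * n)) (lambda : R) :
    'rV[R]_(2 * n + 1) :=
  row_mx w (lambda%:M : 'rV[R]_1).

Definition partial_wl {R : realType} {n : nat}
    (alpha : 'I_(2 * n) -> nat) (beta : nat)
    (f : 'rV[R]_(2 * n + 1) -> R) : 'rV[R]_(2 * n + 1) -> R :=
  foldr (fun i g => iter (alpha i) (partial (lshift 1 i)) g)
        (iter beta (partial (rshift (2 * n) ord0)) f)
        (enum 'I_(2 * n)).

Definition rho {R : realType} {n : nat} (w : 'rV[R]_(2 * n)) (lambda : R) : R :=
  Num.sqrt (1 + enorm w ^+ 2 + `|lambda| ^+ 2).

Definition weight {R : realType} {n : nat}
    (m : 'rV[R]_(2 * n) -> R -> R) : Prop :=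
  (forall w lambda, 0 < m w lambda) /\
  exists (C : R) (N : nat), 0 < C /\
    forall (u w : 'rV[R]_(2 * n)) (lambda : R), lambda != 0 ->
      (enorm (u - w) <= C^-1 * rho w lambda ->
         m w lambda / m u lambda <= C /\
         (m w lambda / m u lambda)^-1 <= C) /\
      (let B := C * (1 + `|lambda|^-1 * rho w lambda * enorm (u - w)) ^+ N in
         m w lambda / m u lambda <= B /\
         (m w lambda / m u lambda)^-1 <= B).

Definition admissible {R : realType} {n : nat}
    (psi : 'rV[R]_(2 * n + 1) -> R[i]) : Prop :=
  let psiR := fun xi => complex.Re (psi xi) in
  [/\ negative_definite psi,
      forall xi, complex.Im (psi xi) = 0,
      weight (fun w lambda => 1 + psiR (pt w lambda)) /\
      (exists C : R, forall w lambda, psiR (pt w lambda) <= C * rho w lambda) &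
      smooth psiR /\
      forall (alpha : 'I_(2 * n) -> nat) (beta : nat),
        exists c : R, forall (w : 'rV[R]_(2 * n)) (lambda : R),
          `|partial_wl alpha beta psiR (pt w lambda)| <=
          c * (1 + psiR (pt w lambda)) *
          rho w lambda ^- (\sum_(i < 2 * n) alpha i + beta)].

(* Main.v *)
(* Negative definiteness: F = expR (- t u) is completely monotone.  Expanding the
   Bernstein polynomial of F on [1, 1 + a] in powers of 1 - x/a, the coefficients are
   iterated differences of F, hence nonnegative, and their sum is F 1.  Since
   (1 - x/a)^k differs from exp (- k x/a) by at most x/a, letting the degree and then
   a grow shows that F (1 + x) is, uniformly on bounded sets, a limit of nonnegative
   combinations of exponentials exp (- r x).  At x = |xi|^2 these are Gaussians, which
   are positive definite.
   Symbol estimates: a partial derivative of order k of u (1 + |xi|^2) is a combination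
   of terms xi^gamma u^(j) (1 + |xi|^2) with 2 j - |gamma| = k, and monotonicity of
   |u^(j)| gives |u^(j) t| <= c_j t^-j u t.
   Weight: for s <= t, u t <= 2 (t / s) u s, and rho (., lambda) is 1-Lipschitz. *)

Require Import Defs.
From mathcomp Require Import all_boot all_order all_algebra.
From mathcomp Require Import complex.
From mathcomp Require Import all_classical all_reals all_analysis.
From mathcomp Require Import ring lra.

Import Order.TTheory GRing.Theory Num.Theory.
Import numFieldNormedType.Exports.

Local Open Scope classical_set_scope.
Local Open Scope complex_scope.
Local Open Scope ring_scope.

(** * Complete monotonicity to finite order *)

Section CompletelyMonotone.
Context {R : realType}.
Implicit Types (f g df : R -> R) (x y z h : R) (k : nat).

Lemma mvt_pos f df x y : (forall z, 0 < z -> is_derive z 1 f (df z)) ->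
  0 < x -> x <= y ->
  exists2 c, x <= c <= y & f y - f x = df c * (y - x).
Proof.
move=> fdf x0 xy.
have [z| |c] := @MVT_segment R f df x y xy.
- by rewrite in_itv /= => /andP[xz _]; apply: fdf; exact: lt_trans xz.
- apply: derivable_within_continuous => z; rewrite in_itv /= => /andP[xz _].
  by have [] := fdf z (lt_le_trans x0 xz).
- by rewrite in_itv /= => cxy fE; exists c.
Qed.

(* Complete monotonicity on ]0, +oo[ up to order [k]; [g] is minus the derivative of [f],
   quantified so that its values outside ]0, +oo[ do not matter. *)
Fixpoint cmonotone k f : Prop :=
  (forall x, 0 < x -> 0 <= f x) /\
  if k is k'.+1 then
    exists2 g, (forall x, 0 < x -> is_derive x 1 f (- g x)) & cmonotone k' g
  else True.

Lemma cmonotone_ge0 k f x : cmonotone k f -> 0 < x -> 0 <= f x.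
Proof. by case: k => [|k] [f0 _] /f0. Qed.

Lemma cmonotoneW k f : cmonotone k.+1 f -> cmonotone k f.
Proof.
elim: k f => [|k IH] f; first by case.
by case=> f0 [g fg /IH gk]; split => //; exists g.
Qed.

Lemma cmonotoneD k f g :
  cmonotone k f -> cmonotone k g -> cmonotone k (fun x => f x + g x).
Proof.
elim: k f g => [|k IH] f g [f0 fk] [g0 gk]; split => //.
- by move=> x x0; rewrite addr_ge0 ?f0 ?g0.
- by move=> x x0; rewrite addr_ge0 ?f0 ?g0.
case: fk gk => [f' df kf'] [g' dg kg']; exists (fun x => f' x + g' x); last exact: IH.
move=> x x0; have ? := df x x0; have ? := dg x x0.
by apply: is_derive_eq; rewrite opprD.
Qed.

(** Leibniz rule: minus the derivative of [f g] is [f' g + f g'], where [f'] and [g'] stand for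
    minus the derivatives, so every sign stays positive. *)
Lemma cmonotoneM k f g :
  cmonotone k f -> cmonotone k g -> cmonotone k (fun x => f x * g x).
Proof.
elim: k f g => [|k IH] f g fk gk; split => //;
  try by move=> x x0; rewrite mulr_ge0 ?(cmonotone_ge0 _ _ _ fk) ?(cmonotone_ge0 _ _ _ gk).
have [fk' gk'] := (cmonotoneW _ _ fk, cmonotoneW _ _ gk).
case: fk gk => [_ [f' df kf']] [_ [g' dg kg']].
exists (fun x => f' x * g x + f x * g' x); last by apply: cmonotoneD; exact: IH.
move=> x x0; have ? := df x x0; have ? := dg x x0.
apply: is_derive_eq; rewrite /GRing.scale /=; ring.
Qed.

Lemma cmonotoneZ k f a : 0 <= a -> cmonotone k f -> cmonotone k (fun x => a * f x).
Proof.
move=> a0; elim: k f => [|k IH] f [f0 fk]; split => //;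
  try by move=> x x0; rewrite mulr_ge0 ?f0.
case: fk => [f' df kf']; exists (fun x => a * f' x); last exact: IH.
move=> x x0; have ? := df x x0.
by apply: is_derive_eq; rewrite /GRing.scale /= mulrN.
Qed.

Lemma cmonotone_shift k f h : 0 <= h ->
  cmonotone k f -> cmonotone k (fun x => f (x + h)).
Proof.
move=> h0; elim: k f => [|k IH] f [f0 fk]; split => //;
  try by move=> x x0; rewrite f0 ?ltr_wpDr.
case: fk => [f' df kf']; exists (fun x => f' (x + h)); last exact: IH.
move=> x x0; have ? : is_derive (x + h) 1 f (- f' (x + h)).
  by apply: df; rewrite ltr_wpDr.
have ? : is_derive x 1 (fun y : R => y + h) (1 : R).
  by apply: is_derive_eq; rewrite addr0.
have H := @is_derive1_comp R f (fun y => y + h) x _ _ _ _.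
have {}H := H _ _.
by apply: is_derive_eq; rewrite mulr1.
Qed.

Lemma cmonotone_noninc f x y : cmonotone 1 f -> 0 < x -> x <= y -> f y <= f x.
Proof.
move=> [f0 [g df [g0 _]]] x0 xy.
have [c /andP[xc cy] fE] := mvt_pos f (fun z => - g z) x y df x0 xy.
rewrite -subr_le0 fE mulNr oppr_le0 mulr_ge0 ?subr_ge0 ?g0//.
exact: lt_le_trans xc.
Qed.

Lemma cmonotone_le1 k f : cmonotone k.+1 f -> cmonotone 1 f.
Proof. by elim: k => // k IH /cmonotoneW. Qed.

(** Differencing commutes with differentiation, so the induction passes to [g]. One order is lost
    because nonnegativity of a difference already uses the sign of one derivative. *)
Lemma cmonotone_diff k f h : 0 <= h ->
  cmonotone k.+1 f -> cmonotone k (fun x => f x - f (x + h)).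
Proof.
move=> h0.
have nonneg j g : cmonotone j.+1 g -> forall x, 0 < x -> 0 <= g x - g (x + h).
  move=> gj x x0; rewrite subr_ge0 (cmonotone_noninc g)//; last by rewrite lerDl.
  exact: cmonotone_le1 gj.
elim: k f => [|k IH] f fk; split => //; try exact: nonneg fk.
have fh := cmonotone_shift _ _ _ h0 fk.
case: fk => _ [g df gk]; exists (fun x => g x - g (x + h)); last exact: IH.
move=> x x0; have ? := df x x0.
have ? : is_derive (x + h) 1 f (- g (x + h)) by apply: df; rewrite ltr_wpDr.
have ? : is_derive x 1 (fun y : R => y + h) (1 : R).
  by apply: is_derive_eq; rewrite addr0.
have H := @is_derive1_comp R f (fun y => y + h) x _ _ _ _.
have {}H := H _ _.
apply: is_derive_eq; rewrite mulr1; ring.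
Qed.

(** Minus the derivative is itself nonincreasing, so its value at 1 is a Lipschitz constant on [[1,
    +oo[]. *)
Lemma cmonotone_lipschitz f : cmonotone 2 f ->
  exists2 L, 0 <= L & forall x y, 1 <= x -> 1 <= y -> `|f x - f y| <= L * `|x - y|.
Proof.
move=> [f0 [g df gk]]; exists (g 1); first exact: (cmonotone_ge0 1).
have main x y : 1 <= x -> x <= y -> `|f x - f y| <= g 1 * `|x - y|.
  move=> x1 xy; have x0 : 0 < x by exact: lt_le_trans x1.
  have [c /andP[xc cy] fE] := mvt_pos f (fun z => - g z) x y df x0 xy.
  have c0 : 0 < c by exact: lt_le_trans xc.
  rewrite distrC fE normrM normrN (distrC y) ler_wpM2r//.
  rewrite ger0_norm ?(cmonotone_ge0 1)// cmonotone_noninc//.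
  exact: le_trans xc.
move=> x y x1 y1; case: (leP x y) => [xy|/ltW yx]; first exact: main.
by rewrite distrC (distrC x) main.
Qed.

End CompletelyMonotone.

(** * Bernstein polynomials and approximation by sums of exponentials *)

Section BernsteinPolynomials.
Context {R : realType}.
Implicit Types (f g : R -> R) (h z s : R).

(* The mean of [f (s + h X)] for [X] binomial with parameters [m] and [z]. *)
Fixpoint binomial_mean h z m f s : R :=
  if m is m'.+1
  then (1 - z) * binomial_mean h z m' f s + z * binomial_mean h z m' f (s + h)
  else f s.

Lemma binomial_mean_le h z m f g s : 0 <= h -> 0 <= z <= 1 ->
  (forall x, s <= x -> f x <= g x) ->
  binomial_mean h z m f s <= binomial_mean h z m g s.
Proof.
move=> h0 /andP[z0 z1]; elim: m s => [|m IH] s fg /=; first exact: fg.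
rewrite lerD// ler_wpM2l ?subr_ge0// IH// => x sx.
by apply: fg; apply: le_trans sx; rewrite lerDl.
Qed.

(** Bias-variance decomposition: [s + h X] has mean [s + m h z] and variance [m h^2 z (1 - z)]. *)
Lemma binomial_mean_quadratic h z m a b c s :
  binomial_mean h z m (fun x => a + b * (x - c) ^+ 2) s =
  a + b * ((s + m%:R * h * z - c) ^+ 2 + m%:R * h ^+ 2 * z * (1 - z)).
Proof.
elim: m s => [|m IH] s /=; first by ring.
by rewrite !IH -natr1; ring.
Qed.

Lemma binomial_mean_diff h z m f s :
  binomial_mean h z m (fun x => f x - f (x + h)) s =
  binomial_mean h z m f s - binomial_mean h z m f (s + h).
Proof. by elim: m s => [//|m IH] s /=; rewrite !IH; ring. Qed.

Lemma binomial_mean_shift h z m f s :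
  binomial_mean h z m (fun x => f (x + h)) s = binomial_mean h z m f (s + h).
Proof. by elim: m s => [//|m IH] s /=; rewrite !IH. Qed.

(* With [D f x = f x - f (x + h)], one step of the mean reads
   [f (x + h) + (1 - z) D f x], which has the sign needed in powers of [1 - z]. *)
Lemma binomial_mean_poly h m f s : 0 <= h -> 0 < s -> cmonotone m f ->
  exists2 p : {poly R}, (forall i, 0 <= p`_i) &
    forall z, binomial_mean h z m f s = p.[1 - z].
Proof.
move=> h0 s0; elim: m f => [|m IH] f fm.
  exists (f s)%:P; last by move=> z; rewrite hornerC.
  by move=> i; rewrite coefC; case: eqP => // _; exact: (cmonotone_ge0 0).
have [p p0 pE] := IH _ (cmonotone_shift _ _ _ h0 (cmonotoneW _ _ fm)).
have [q q0 qE] := IH _ (cmonotone_diff _ _ _ h0 fm).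
exists (p + q * 'X).
  by move=> i; rewrite coefD coefMX addr_ge0//; case: ifP.
move=> z; rewrite hornerD hornerMX -pE -qE binomial_mean_diff binomial_mean_shift /=.
ring.
Qed.

(** Chebyshev-type argument: [L d <= e + L^2 / e * d^2] replaces the Lipschitz modulus by a
    quadratic centred at the mean [c], and the binomial mean of that quadratic only sees the
    variance. *)
Lemma binomial_mean_lipschitz h z m f s L e : 0 <= h -> 0 <= z <= 1 -> 0 < e ->
  (forall x y, s <= x -> s <= y -> `|f x - f y| <= L * `|x - y|) ->
  `|f (s + m%:R * h * z) - binomial_mean h z m f s| <=
    e + L ^+ 2 / e * (m%:R * h ^+ 2 * z * (1 - z)).
Proof.
move=> h0 z01 e0 fL; set c := s + _.
have sc : s <= c by rewrite lerDl !mulr_ge0//; case/andP: z01.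
have bnd x : s <= x -> `|f x - f c| <= e + L ^+ 2 / e * (x - c) ^+ 2.
  move=> sx; apply: le_trans (fL x c sx sc) _.
  set d := `|x - c|; have -> : (x - c) ^+ 2 = d ^+ 2 by rewrite real_normK ?num_real.
  rewrite -(ler_pM2r e0) mulrDl.
  have -> : L ^+ 2 / e * d ^+ 2 * e = (L * d) ^+ 2 by field; rewrite gt_eqF.
  have := sqr_ge0 (L * d - e); have := sqr_ge0 (L * d + e); nra.
rewrite distrC; set V := m%:R * _ * _ * _; set B := L ^+ 2 / e in bnd *.
have VE : forall a b, binomial_mean h z m (fun x => a + b * (x - c) ^+ 2) s = a + b * V.
  by move=> a b; rewrite binomial_mean_quadratic subrr expr0n/= add0r.
rewrite ler_distl; apply/andP; split.
- have -> : f c - (e + B * V) = (f c - e) + (- B) * V by ring.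
  rewrite -VE; apply: binomial_mean_le => // x sx.
  have := bnd x sx; rewrite ler_distl => /andP[+ _]; lra.
- have -> : f c + (e + B * V) = (f c + e) + B * V by ring.
  rewrite -VE; apply: binomial_mean_le => // x sx.
  have := bnd x sx; rewrite ler_distl => /andP[_]; lra.
Qed.

Lemma expR_sub_pow_bound (v : R) k : 0 <= v <= 1 ->
  `|(1 - v) ^+ k - expR (- (k%:R * v))| <= v.
Proof.
move=> /andP[v0 v1].
have -> : expR (- (k%:R * v)) = expR (- v) ^+ k.
  by rewrite -expRM_natl mulrN.
set q := expR (- v).
have q0 : 0 <= q by exact: expR_ge0.
have pq : 1 - v <= q by exact: expR_ge1Dx.
have qv : q * (1 + v) <= 1.
  have := expR_ge1Dx v; have := expRxMexpNx_1 v; rewrite -/q; nra.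
have p0 : 0 <= 1 - v by lra.
have lo : (1 - v) ^+ k <= q ^+ k by rewrite lerXn2r ?nnegrE.
(* Stronger than [q^k - (1 - v)^k <= v], so that the induction closes: using [q (1 + v) <= 1], the
   step reduces to [v^2 (1 - v)^k <= v^2]. *)
have hi : (1 + v) * q ^+ k <= v + (1 - v) ^+ k.
  elim: k {lo} => [|k IH]; first by rewrite !expr0; lra.
  rewrite !exprS.
  have : (1 - v) ^+ k <= 1 by rewrite exprn_ile1//; lra.
  have := exprn_ge0 k p0; move: IH; set P := (1 - v) ^+ k; set Q := q ^+ k.
  by nra.
have := exprn_ge0 k q0; rewrite ler_distl; nra.
Qed.

Lemma gaussian_approx (f : R -> R) (X e : R) : 0 <= X -> 0 < e ->
  (forall k, cmonotone k f) ->
  exists (n : nat) (c r : 'I_n -> R),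
    (forall i, 0 <= c i /\ 0 <= r i) /\
    forall x, 0 <= x <= X -> `|f (1 + x) - \sum_(i < n) c i * expR (- (r i * x))| <= e.
Proof.
move=> X0 e0 fcm; have [L L0 fL] := cmonotone_lipschitz f (fcm 2).
have f1 : 0 <= f 1 by exact: (cmonotone_ge0 0).
(* [a >= X] keeps [z = x / a] in [[0, 1]]; the last summand makes [f 1 * z], the cost of replacing
   powers by exponentials, at most [e / 3]. *)
pose a := X + 1 + f 1 * X / (e / 3).
have fXe : 0 <= f 1 * X / (e / 3) by rewrite !mulr_ge0 ?invr_ge0; lra.
have a0 : 0 < a by rewrite /a; lra.
pose B := L ^+ 2 / (e / 3).
have B0 : 0 <= B by rewrite mulr_ge0 ?sqr_ge0 ?invr_ge0; lra.
(* The degree [K] is chosen so that the variance term, at most [B a^2 / K], is below [e / 3]. The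
   remaining third is the free parameter of [binomial_mean_lipschitz]. *)
pose K := (Num.truncn (B * a ^+ 2 / (e / 3))).+1.
have K0 : 0 < K%:R :> R by rewrite ltr0n.
have KB : B * a ^+ 2 / K%:R <= e / 3.
  rewrite ler_pdivrMr// -ler_pdivrMl; last by lra.
  by rewrite mulrC; exact/ltW/truncnS_gt.
(* With this step size the mean [1 + K h z] is exactly [1 + x]. *)
pose h := a / K%:R.
have h0 : 0 <= h by rewrite divr_ge0 ?ltW.
have [p p0 pE] := binomial_mean_poly h K f 1 h0 ltr01 (fcm K).
exists (size p), (fun i => p`_i), (fun i => i%:R / a); split.
  by move=> i; split=> //; rewrite divr_ge0// ltW.
move=> x /andP[x0 xX]; pose z := x / a.
have z01 : 0 <= z <= 1.
  rewrite divr_ge0 ?(ltW a0)//= ler_pdivrMr// mul1r /a; lra.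
have zX : f 1 * z <= e / 3.
  rewrite /z mulrA ler_pdivrMr// -ler_pdivrMl; last by lra.
  rewrite mulrC /a; apply: (@le_trans _ _ (f 1 * X / (e / 3))); last by lra.
  by rewrite ler_wpM2r ?invr_ge0 ?ler_wpM2l//; lra.
(* Take [z = 0]: the binomial is then concentrated at 0, and the polynomial is evaluated at 1. *)
have p1 : \sum_(i < size p) p`_i = f 1.
  have := pE 0; rewrite subr0 horner_coef.
  under eq_bigr do rewrite expr1n mulr1.
  move=> <-; elim: (K) => [//|m IH] /=; rewrite IH; ring.
have e30 : 0 < e / 3 by lra.
have := binomial_mean_lipschitz h z K f 1 L (e / 3) h0 z01 e30 fL.
have -> : 1 + K%:R * h * z = 1 + x.
  by rewrite /h /z; field; rewrite (gt_eqF K0) (gt_eqF a0).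
rewrite -/B pE => H1.
have {}H1 : `|f (1 + x) - p.[1 - z]| <= e / 3 + e / 3.
  apply: le_trans H1 _; rewrite lerD2l; apply: le_trans KB.
  have -> : B * a ^+ 2 / K%:R = B * (K%:R * h ^+ 2).
    by rewrite /h; field; rewrite gt_eqF.
  have Kh0 : 0 <= K%:R * h ^+ 2 by rewrite mulr_ge0 ?sqr_ge0.
  rewrite ler_wpM2l// -mulrA ler_piMr//; case/andP: z01 => ? ?; nra.
have H2 : `|p.[1 - z] - \sum_(i < size p) p`_i * expR (- (i%:R / a * x))| <= e / 3.
  apply: le_trans zX; rewrite horner_coef -sumrB -p1 mulr_suml.
  apply: le_trans (ler_norm_sum _ _ _) _; apply: ler_sum => i _.
  rewrite -mulrBr normrM ger0_norm// ler_wpM2l//.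
  by rewrite -[_ / a * x]mulrAC -mulrA expR_sub_pow_bound.
have := ler_distD p.[1 - z] (f (1 + x)) (\sum_(i < size p) p`_i * expR (- (i%:R / a * x))).
rewrite /=; lra.
Qed.

End BernsteinPolynomials.

(** * Positive semidefinite kernels on a finite index set *)

Section PositiveSemidefinite.
Context {R : realType} {N : nat}.
Implicit Types (M : 'I_N -> 'I_N -> R).

(** Only real coefficients are tested; complex ones are handled in [positive_definite_real], where
    evenness of the function provides the symmetry. *)
Definition psd M := forall c : 'I_N -> R,
  0 <= \sum_(j < N) \sum_(k < N) M j k * c j * c k.

Lemma eq_psd M M' : (forall j k, M j k = M' j k) -> psd M -> psd M'.
Proof. by move=> MM' pM c; under eq_bigr do under eq_bigr do rewrite -MM'. Qed.

Lemma psd_rescale (b : 'I_N -> R) M : psd M -> psd (fun j k => b j * b k * M j k).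
Proof.
move=> pM c; have := pM (fun j => b j * c j); congr (_ <= _).
by apply: eq_bigr => j _; apply: eq_bigr => k _; ring.
Qed.

Lemma psd_scale a M : 0 <= a -> psd M -> psd (fun j k => a * M j k).
Proof.
move=> a0 pM c; have := mulr_ge0 a0 (pM c); rewrite mulr_sumr; congr (_ <= _).
by apply: eq_bigr => j _; rewrite mulr_sumr; apply: eq_bigr => k _; ring.
Qed.

Lemma psd_sum n (M : 'I_n -> 'I_N -> 'I_N -> R) :
  (forall i, psd (M i)) -> psd (fun j k => \sum_(i < n) M i j k).
Proof.
move=> pM c; have : 0 <= \sum_(i < n) \sum_(j < N) \sum_(k < N) M i j k * c j * c k.
  by apply: sumr_ge0 => i _; exact: pM.
rewrite exchange_big; congr (_ <= _); apply: eq_bigr => j _.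
by rewrite exchange_big; apply: eq_bigr => k _; rewrite -!mulr_suml.
Qed.

Lemma psd_cvg (F : nat -> 'I_N -> 'I_N -> R) M :
  (forall j k, F m j k @[m --> \oo] --> M j k) -> (forall m, psd (F m)) -> psd M.
Proof.
move=> FM pF c.
suff H : \sum_(j < N) \sum_(k < N) F m j k * c j * c k @[m --> \oo] -->
    \sum_(j < N) \sum_(k < N) M j k * c j * c k.
  by apply: (cvgr_to_ge H); apply: nearW => m; exact: pF.
apply: cvg_big => [|j _]; first exact: add_continuous.
apply: cvg_big => [|k _]; first exact: add_continuous.
by apply: cvgM; [apply: cvgM; [exact: FM|exact: cvg_cst]|exact: cvg_cst].
Qed.

Lemma psd_approx M :
  (forall e, 0 < e -> exists2 M', psd M' & forall j k, `|M j k - M' j k| <= e) ->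
  psd M.
Proof.
move=> H; have H' m : exists M', psd M' /\ forall j k, `|M j k - M' j k| <= m.+1%:R^-1.
  by have [|M' ? ?] := H m.+1%:R^-1; [rewrite invr_gt0|exists M'].
have [F /all_and2[pF FM]] := choice H'.
apply: (psd_cvg F) => // j k; apply/cvgrPdist_le => e e0.
near=> m; apply: le_trans (FM m j k) _.
near: m; have := near_infty_natSinv_lt (PosNum e0).
by apply: filterS => m /ltW.
Unshelve. all: by end_near. Qed.

(** The instance of the Schur product theorem that is used: multiplying by the Gram matrix is a sum
    over [i] of the rescalings by [x j i * x k i]. *)
Lemma psd_gram_pow d (x : 'I_N -> 'I_d -> R) m :
  psd (fun j k => (\sum_(i < d) x j i * x k i) ^+ m).
Proof.
elim: m => [|m IH] c.
  have -> : \sum_(j < N) \sum_(k < N) (\sum_(i < d) x j i * x k i) ^+ 0 * c j * c k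
      = (\sum_(j < N) c j) ^+ 2; last exact: sqr_ge0.
  rewrite expr2 mulr_suml; apply: eq_bigr => j _; rewrite mulr_sumr.
  by apply: eq_bigr => k _; rewrite expr0 mul1r.
have : psd (fun j k => \sum_(i < d) (x j i * x k i * (\sum_(i < d) x j i * x k i) ^+ m)).
  by apply: psd_sum => i; apply: psd_rescale.
move=> /(_ c); congr (_ <= _); apply: eq_bigr => j _; apply: eq_bigr => k _.
by rewrite -mulr_suml exprS.
Qed.

(** The exponential series has nonnegative coefficients, so its partial sums at [r] times the Gram
    matrix are positive semidefinite, and so is their entrywise limit. *)
Lemma psd_exp_gram d (x : 'I_N -> 'I_d -> R) r : 0 <= r ->
  psd (fun j k => expR (r * \sum_(i < d) x j i * x k i)).
Proof.
move=> r0.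
apply: (psd_cvg (fun m j k => series (exp_coeff (r * \sum_(i < d) x j i * x k i)) m)).
  by move=> j k; exact: is_cvg_series_exp_coeff.
move=> m; apply: (eq_psd (fun j k => \sum_(l < m)
    r ^+ l / l`!%:R * (\sum_(i < d) x j i * x k i) ^+ l)).
  move=> j k; rewrite /series /= big_mkord; apply: eq_bigr => l _.
  by rewrite /exp_coeff /= exprMn mulrAC.
apply: psd_sum => l; apply: psd_scale; first by rewrite mulr_ge0 ?exprn_ge0 ?invr_ge0.
exact: psd_gram_pow.
Qed.

End PositiveSemidefinite.

(** * Positive definiteness of radial functions *)

Section RadialFunctions.
Context {R : realType}.

Lemma enorm_sqr d (x : 'rV[R]_d) : enorm x ^+ 2 = \sum_(i < d) x 0 i ^+ 2.
Proof. by rewrite sqr_sqrtr// sumr_ge0// => i _; exact: sqr_ge0. Qed.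

(** Expanding the squared distance turns the Gaussian into the exponential of [2 r] times the Gram
    matrix, rescaled by [b]. *)
Lemma psd_gaussian N d (x : 'I_N -> 'rV[R]_d) r : 0 <= r ->
  psd (fun j k => expR (- (r * enorm (x j - x k) ^+ 2))).
Proof.
move=> r0; pose b j := expR (- (r * enorm (x j) ^+ 2)).
have r20 : 0 <= 2 * r by rewrite mulr_ge0.
have := psd_rescale b _ (psd_exp_gram d (fun j i => x j 0 i) (2 * r) r20).
apply: eq_psd => j k; rewrite /b -!expRD; congr expR.
have -> : enorm (x j - x k) ^+ 2 =
    enorm (x j) ^+ 2 + enorm (x k) ^+ 2 - 2 * \sum_(i < d) x j 0 i * x k 0 i.
  rewrite !enorm_sqr mulr_sumr -sumrN -!big_split; apply: eq_bigr => i _ /=.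
  by rewrite !mxE; ring.
ring.
Qed.

Lemma psd_completely_monotone N d (f : R -> R) (x : 'I_N -> 'rV[R]_d) :
  (forall k, cmonotone k f) -> psd (fun j k => f (1 + enorm (x j - x k) ^+ 2)).
Proof.
move=> fcm; apply: psd_approx => e e0.
(* Finitely many squared distances occur and [X] bounds them all, so approximation on [[0, X]]
   suffices. *)
pose X := \sum_(j < N) \sum_(k < N) enorm (x j - x k) ^+ 2.
have nn j k : 0 <= enorm (x j - x k) ^+ 2 by exact: sqr_ge0.
have X0 : 0 <= X by do 2 apply: sumr_ge0 => ? _.
have xX j k : enorm (x j - x k) ^+ 2 <= X.
  rewrite /X (bigD1 j)//= (bigD1 k)//= -addrA lerDl addr_ge0// sumr_ge0// => i _.
  exact: sumr_ge0.
have [n [c [r [cr0 H]]]] := gaussian_approx f X e X0 e0 fcm.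
exists (fun j k => \sum_(i < n) c i * expR (- (r i * enorm (x j - x k) ^+ 2))).
  apply: psd_sum => i; have [? ?] := cr0 i; apply: psd_scale => //.
  exact: psd_gaussian.
by move=> j k; apply: H; rewrite nn xX.
Qed.

Lemma enormN d (x : 'rV[R]_d) : enorm (- x) = enorm x.
Proof.
by congr Num.sqrt; apply: eq_bigr => i _; rewrite mxE sqrrN.
Qed.

Lemma cexp_real (a : R) : cexp a%:C = (expR a)%:C.
Proof.
by rewrite /cexp /= cos0 sin0; apply/eqP; rewrite eq_complex /= !mulr0 !mul0r !addr0 mulr1 subr0 !eqxx.
Qed.

(** For [c = a + i b] the real part is the sum of the quadratic forms at [a] and at [b]; by evenness
    of [phi] the imaginary part is antisymmetric in [(j, k)] and cancels. *)
Lemma positive_definite_real d (phi : 'rV[R]_d -> R) :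
  (forall x, phi (- x) = phi x) ->
  (forall N (x : 'I_N -> 'rV[R]_d), psd (fun j k => phi (x j - x k))) ->
  positive_definite (fun x => (phi x)%:C).
Proof.
move=> phiN phip N x c.
have ReS n (z : 'I_n -> R[i]) : complex.Re (\sum_(i < n) z i) = \sum_(i < n) complex.Re (z i).
  by apply: big_morph => // -[? ?] [].
have ImS n (z : 'I_n -> R[i]) : complex.Im (\sum_(i < n) z i) = \sum_(i < n) complex.Im (z i).
  by apply: big_morph => // -[? ?] [].
pose a j := complex.Re (c j); pose b j := complex.Im (c j).
have ReE j k : complex.Re ((phi (x j - x k))%:C * c j * (c k)^*) =
    phi (x j - x k) * a j * a k + phi (x j - x k) * b j * b k.
  by rewrite /a /b; case: (c j) => ? ?; case: (c k) => ? ? /=; ring.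
have ImE j k : complex.Im ((phi (x j - x k))%:C * c j * (c k)^*) =
    phi (x j - x k) * b j * a k - phi (x j - x k) * a j * b k.
  by rewrite /a /b; case: (c j) => ? ?; case: (c k) => ? ? /=; ring.
rewrite lecE /=; apply/andP; split.
  rewrite ImS; under eq_bigr do rewrite ImS; apply/eqP.
  under eq_bigr do under eq_bigr do rewrite ImE.
  under eq_bigr do rewrite sumrB.
  rewrite sumrB [X in _ - X]exchange_big /=; apply/eqP; rewrite subr_eq0; apply/eqP.
  apply: eq_bigr => j _; apply: eq_bigr => k _.
  by rewrite -[x k - x j]opprB phiN; ring.
rewrite ReS; under eq_bigr do rewrite ReS.
under eq_bigr do under eq_bigr do rewrite ReE.
under eq_bigr do rewrite big_split.
by rewrite big_split addr_ge0//; exact: phip.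
Qed.

End RadialFunctions.

(** * Derivative and growth estimates for Bernstein functions *)

Section BernsteinFunctions.
Context {R : realType}.
Context (u : R -> R) (hu : bernstein u).
Implicit Types (x y s t : R) (j k : nat).

Lemma bernstein_ge0 x : 0 < x -> 0 <= u x.
Proof. by have [_ _ + _] := hu; apply. Qed.

Lemma bernstein_is_derive j x : 0 < x ->
  is_derive x 1 (u^`(j))%classic ((u^`(j.+1))%classic x).
Proof.
move=> x0; have [du _ _ _] := hu; rewrite derive1nS derive1E.
by apply: derivableP; exact: du.
Qed.

Lemma bernstein_cmonotone k j :
  cmonotone k (fun x => (-1) ^+ j * (u^`(j.+1))%classic x).
Proof.
have nonneg i x : 0 < x -> 0 <= (-1) ^+ i * (u^`(i.+1))%classic x.
  by move=> x0; have [_ _ _ /(_ i.+1 x isT x0)] := hu; rewrite exprS mulN1r mulNr oppr_le0.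
elim: k j => [|k IH] j; split => //; try exact: nonneg.
exists (fun x => (-1) ^+ j.+1 * (u^`(j.+2))%classic x); last exact: IH.
move=> x x0; have ? := bernstein_is_derive j.+1 x x0.
by apply: is_derive_eq; rewrite /GRing.scale /= exprS mulN1r mulNr opprK.
Qed.

(* The derivative of [expR (- t u)] is [- (t u')] times itself, so complete
   monotonicity to order [k] propagates to order [k + 1]. *)
Lemma bernstein_exp_cmonotone t k : 0 <= t ->
  cmonotone k (fun x => expR (- (t * u x))).
Proof.
move=> t0; elim: k => [|k IH]; split => //; try by move=> x _; exact: expR_ge0.
exists (fun x => t * (u^`(1))%classic x * expR (- (t * u x))).
  move=> x x0; have ? : is_derive x 1 u ((u^`(1))%classic x).
    exact: (bernstein_is_derive 0).
  apply: is_derive_eq; rewrite /GRing.scale /=; ring.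
apply: cmonotoneM IH; apply: cmonotoneZ => //.
have := bernstein_cmonotone k 0; congr cmonotone.
by apply/funext => x; rewrite expr0 mul1r.
Qed.

Lemma bernstein_derive_noninc j x y : 0 < x -> x <= y ->
  `|(u^`(j.+1))%classic y| <= `|(u^`(j.+1))%classic x|.
Proof.
move=> x0 xy; have y0 : 0 < y := lt_le_trans x0 xy.
have cj := bernstein_cmonotone 1 j.
rewrite -(normrMsign j) -[leRHS](normrMsign j).
rewrite !ger0_norm ?(cmonotone_ge0 _ _ _ cj)//.
exact: (cmonotone_noninc _ _ _ cj).
Qed.

Lemma bernstein_derive1_ge0 x : 0 < x -> 0 <= (u^`(1))%classic x.
Proof. by move=> x0; have := cmonotone_ge0 _ _ _ (bernstein_cmonotone 0 0) x0; rewrite mul1r. Qed.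

Lemma bernstein_ndecr x y : 0 < x -> x <= y -> u x <= u y.
Proof.
move=> x0 xy.
have [c /andP[xc _] uE] := mvt_pos u _ x y (bernstein_is_derive 0) x0 xy.
rewrite -subr_ge0 uE mulr_ge0 ?subr_ge0// bernstein_derive1_ge0//.
exact: lt_le_trans xc.
Qed.

(** The mean value theorem on [[t/2, t]] and monotonicity of [|u^(j+1)|] bound [|u^(j+1) t| * t/2]
    by the values of [|u^(j)|] at [t] and [t/2]. The induction hypothesis at [t/2] costs [2^j], and
    [u (t/2) <= u t]. *)
Lemma bernstein_derive_bound j : exists2 c, 0 <= c &
  forall t, 0 < t -> `|(u^`(j))%classic t| * t ^+ j <= c * u t.
Proof.
elim: j => [|j [c c0 IH]].
  by exists 1 => // t t0; rewrite expr0 mulr1 mul1r ger0_norm// bernstein_ge0.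
exists (2 * (c + 2 ^+ j * c)); first by rewrite mulr_ge0 ?addr_ge0 ?mulr_ge0 ?exprn_ge0.
move=> t t0; have t20 : 0 < t / 2 by lra.
have tt2 : t / 2 <= t by lra.
have [x /andP[x1 x2] uE] := mvt_pos _ _ _ _ (bernstein_is_derive j) t20 tt2.
have H1 : `|(u^`(j.+1))%classic t| * (t / 2) <=
    `|(u^`(j))%classic t| + `|(u^`(j))%classic (t / 2)|.
  apply: le_trans (ler_normB _ _); rewrite uE normrM.
  have -> : t - t / 2 = t / 2 by lra.
  rewrite [X in _ <= _ * X]gtr0_norm// ler_wpM2r ?(ltW t20)//.
  by apply: bernstein_derive_noninc x2; exact: lt_le_trans x1.
have H2 := IH _ t0; have H3 := IH _ t20.
have H4 : `|(u^`(j))%classic (t / 2)| * t ^+ j <= 2 ^+ j * c * u t.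
  have -> : t ^+ j = 2 ^+ j * (t / 2) ^+ j by rewrite -exprMn; congr (_ ^+ _); lra.
  rewrite mulrCA -mulrA ler_wpM2l ?exprn_ge0//; apply: le_trans H3 _.
  by rewrite ler_wpM2l// bernstein_ndecr.
have tj : 0 <= t ^+ j by rewrite exprn_ge0// ltW.
have := ler_wpM2r tj H1; rewrite exprS; lra.
Qed.

(** A form of concavity: [u'] is nonincreasing, and at some point of [[s/2, s]] it is at most
    [2 u s / s] because [u (s/2) >= 0]. Starting from [s/2] stays inside the open half-line and
    costs the factor 2. *)
Lemma bernstein_growth s t : 0 < s -> s <= t -> s * u t <= 2 * t * u s.
Proof.
move=> s0 st; have us := bernstein_ge0 s s0.
have s20 : 0 < s / 2 by lra.
have ss2 : s / 2 <= s by lra.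
have [x /andP[x1 x2] xE] := mvt_pos u _ _ _ (bernstein_is_derive 0) s20 ss2.
have [y /andP[y1 y2] yE] := mvt_pos u _ _ _ (bernstein_is_derive 0) s0 st.
have x0 : 0 < x := lt_le_trans s20 x1.
have y0 : 0 < y := lt_le_trans s0 y1.
have := bernstein_derive_noninc 0 x y x0 (le_trans x2 y1).
rewrite !ger0_norm ?bernstein_derive1_ge0//.
have us2 := bernstein_ge0 _ s20.
have := bernstein_derive1_ge0 x x0.
move: xE yE; set a := (u^`(1))%classic x; set b := (u^`(1))%classic y.
move=> xE yE a0 ba.
have H1 : a * s <= 2 * u s by lra.
have H2 : s * (u t - u s) <= (a * s) * (t - s).
  rewrite yE mulrA [s * b]mulrC ler_wpM2r ?subr_ge0//.
  by rewrite ler_wpM2r// ltW.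
have H3 : (a * s) * (t - s) <= 2 * u s * (t - s) by rewrite ler_wpM2r// subr_ge0.
have : 0 <= s * u s by rewrite mulr_ge0// ltW.
lra.
Qed.

Lemma bernstein_ratio (p q k : R) : 0 < p -> 0 < q -> 1 <= k -> p <= k * q ->
  (1 + u (p ^+ 2)) / (1 + u (q ^+ 2)) <= 2 * k ^+ 2.
Proof.
move=> p0 q0 k1 pkq.
have p20 : 0 < p ^+ 2 by rewrite exprn_gt0.
have q20 : 0 < q ^+ 2 by rewrite exprn_gt0.
have up := bernstein_ge0 _ p20; have uq := bernstein_ge0 _ q20.
have k2 : 1 <= k ^+ 2 by rewrite exprn_ege1.
rewrite ler_pdivrMr; last by lra.
have [pq|/ltW qp] := leP p q.
  have : u (p ^+ 2) <= u (q ^+ 2).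
    by rewrite bernstein_ndecr// lerXn2r ?nnegrE ?(ltW p0) ?(ltW q0).
  nra.
have H : q ^+ 2 * u (p ^+ 2) <= 2 * p ^+ 2 * u (q ^+ 2).
  by rewrite bernstein_growth// lerXn2r ?nnegrE ?(ltW p0) ?(ltW q0).
have H2 : p ^+ 2 <= k ^+ 2 * q ^+ 2.
  by rewrite -exprMn lerXn2r ?nnegrE ?mulr_ge0 ?(ltW p0) ?(ltW q0)//; lra.
have : u (p ^+ 2) <= 2 * k ^+ 2 * u (q ^+ 2).
  rewrite -(ler_pM2l q20); apply: le_trans H _.
  have := ler_wpM2r uq H2; lra.
lra.
Qed.

End BernsteinFunctions.

(** * Symbol classes, smoothness and derivative bounds *)

Section Symbols.
Context {R : realType} {d : nat}.
Context (u : R -> R) (hu : bernstein u).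
Implicit Types (f g : 'rV[R]_d -> R).

(* [symbol k f]: [f] is a combination of terms [xi ^ gamma * u^(j) (1 + |xi|^2)]
   with [2 j - |gamma| = k]. *)
Inductive symbol : nat -> ('rV[R]_d -> R) -> Prop :=
| symbol_deriv j : symbol (2 * j) (fun xi => (u^`(j))%classic (1 + enorm xi ^+ 2))
| symbol_coord l k f : symbol k.+1 f -> symbol k (fun xi => xi 0 l * f xi)
| symbol_scale a k f : symbol k f -> symbol k (fun xi => a * f xi)
| symbol_add k f g : symbol k f -> symbol k g -> symbol k (fun xi => f xi + g xi).

(** Reduces directional derivatives to derivatives at 0 in one variable, where the chain rule for
    real functions applies. *)
Lemma is_derive_line f x v df :
  is_derive (0 : R) 1 (fun h : R => f (h *: v + x)) df -> is_derive x v f df.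
Proof.
move=> [dF <-]; apply: DeriveDef; first exact/derivable1P.
rewrite /derive; set g1 := fun h => h^-1 *: _; set g2 := fun h => h^-1 *: _.
suff -> : g1 = g2 by [].
by apply/funext => h; rewrite /g1 /g2 /= addr0 scale0r add0r [_%:A]mulr1.
Qed.

Lemma enorm_sqr_line (x : 'rV[R]_d) i (h : R) :
  enorm (h *: delta_mx 0 i + x) ^+ 2 = enorm x ^+ 2 + 2 * h * x 0 i + h ^+ 2.
Proof.
rewrite !enorm_sqr (bigD1 i)//= [in RHS](bigD1 i)//= !mxE !eqxx mulr1.
rewrite (eq_bigr (fun l => x 0 l ^+ 2)); last first.
  by move=> l /negPf li; rewrite !mxE li mulr0 add0r.
ring.
Qed.

Lemma one_enorm_gt0 (x : 'rV[R]_d) : 0 < 1 + enorm x ^+ 2.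
Proof. by rewrite ltr_pwDl// sqr_ge0. Qed.

(** Differentiating a generator produces [2 xi_i u^(j+1)]: the extra derivative raises the order by
    2 and the coordinate lowers it by 1. *)
Lemma symbol_is_derive k f i : symbol k f ->
  exists2 g, symbol k.+1 g & forall x, is_derive x (delta_mx 0 i) f (g x).
Proof.
elim=> {k f} [j|l k f fk [g gk dg]|a k f _ [g gk dg]|k f g _ [f' fk df] _ [g' gk dg]].
- exists (fun xi : 'rV[R]_d => 2 * (xi 0 i * (u^`(j.+1))%classic (1 + enorm xi ^+ 2))).
    apply: symbol_scale; apply: symbol_coord.
    by have := symbol_deriv j.+1; rewrite mulnS.
  move=> x; apply: is_derive_line.
  have -> : (fun h : R => (u^`(j))%classic (1 + enorm (h *: delta_mx 0 i + x) ^+ 2)) =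
      (u^`(j))%classic \o (fun h : R => 1 + enorm x ^+ 2 + 2 * x 0 i * h + h ^+ 2).
    by apply/funext => h /=; rewrite enorm_sqr_line; congr ((u^`(j))%classic _); ring.
  set p := fun h : R => _ + _ + _.
  have p0 : p 0 = 1 + enorm x ^+ 2 by rewrite /p; ring.
  have dp : is_derive (0 : R) 1 p (2 * x 0 i).
    by apply: is_derive_eq; rewrite /GRing.scale /=; ring.
  have du : is_derive (p 0) 1 (u^`(j))%classic ((u^`(j.+1))%classic (p 0)).
    by apply: bernstein_is_derive => //; rewrite p0 one_enorm_gt0.
  by apply: is_derive_eq; rewrite p0; ring.
- exists (fun xi : 'rV[R]_d => (l == i)%:R * f xi + xi 0 l * g xi).
    by apply: symbol_add; [apply: symbol_scale|apply: symbol_coord].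
  move=> x; have ? := dg x.
  have ? : is_derive x (delta_mx 0 i) (fun xi : 'rV[R]_d => xi 0 l) ((l == i)%:R : R).
    apply: is_derive_line.
    have -> : (fun h : R => (h *: delta_mx 0 i + x) 0 l) =
        (fun h : R => (l == i)%:R * h + x 0 l).
      by apply/funext => h; rewrite !mxE eqxx /= mulrC.
    by apply: is_derive_eq; rewrite /GRing.scale /=; ring.
  apply: is_derive_eq; rewrite /GRing.scale /=; ring.
- exists (fun xi : 'rV[R]_d => a * g xi); first exact: symbol_scale.
  by move=> x; have ? := dg x; apply: is_derive_eq.
- exists (fun xi : 'rV[R]_d => f' xi + g' xi); first exact: symbol_add.
  by move=> x; have ? := df x; have ? := dg x; apply: is_derive_eq.
Qed.

Lemma symbol_partial k f i : symbol k f -> symbol k.+1 (partial i f).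
Proof.
move=> /(symbol_is_derive _ _ i)[g gk dg].
suff -> : partial i f = g by [].
by apply/funext => x; have [_ <-] := dg x.
Qed.

Lemma symbol_derivable k f i x : symbol k f -> derivable f x (delta_mx 0 i).
Proof. by move=> /(symbol_is_derive _ _ i)[g _ dg]; have [] := dg x. Qed.

Lemma enorm_sqr_continuous : continuous (fun x : 'rV[R]_d => enorm x ^+ 2).
Proof.
have -> : (fun x : 'rV[R]_d => enorm x ^+ 2) = (fun x => \sum_(i < d) x 0 i * x 0 i).
  by apply/funext => x; rewrite enorm_sqr; apply: eq_bigr => i _; rewrite expr2.
apply: continuous_big => [|i _ x]; first exact: add_continuous.
have c := @coord_continuous R 1 d 0 i x; exact: (cvgM c c).
Qed.

Lemma symbol_continuous k f : symbol k f -> continuous f.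
Proof.
elim=> {k f} [j|l k f _ cf|a k f _ cf|k f g _ cf _ cg] x.
- apply: (@continuous_comp _ _ _ (fun x => 1 + enorm x ^+ 2) (u^`(j))%classic).
    exact: (cvgD (cvg_cst _) (enorm_sqr_continuous x)).
  apply/differentiable_continuous/derivable1_diffP.
  by have [] := bernstein_is_derive u hu j _ (one_enorm_gt0 x).
- exact: (cvgM (@coord_continuous R 1 d 0 l x) (cf x)).
- exact: (cvgM (cvg_cst a) (cf x)).
- exact: (cvgD (cf x) (cg x)).
Qed.

Lemma coord_le_enorm (x : 'rV[R]_d) l : `|x 0 l| <= enorm x.
Proof.
rewrite -sqrtr_sqr ler_wsqrtr// (bigD1 l)//= lerDl.
by apply: sumr_ge0 => i _; exact: sqr_ge0.
Qed.

(** For a generator, [rho^(2 j) = (1 + |xi|^2)^j] and [bernstein_derive_bound] applies; a coordinate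
    factor is absorbed by one power of [rho]. *)
Lemma symbol_bound k f : symbol k f -> exists2 c, 0 <= c &
  forall x, `|f x| * Num.sqrt (1 + enorm x ^+ 2) ^+ k <= c * u (1 + enorm x ^+ 2).
Proof.
elim=> {k f} [j|l k f _ [c c0 fc]|a k f _ [c c0 fc]|k f g _ [c c0 fc] _ [b b0 gb]].
- have [c c0 uc] := bernstein_derive_bound u hu j; exists c => // x.
  have t0 := one_enorm_gt0 x.
  by rewrite exprM sqr_sqrtr ?(ltW t0)//; exact: uc.
- exists c => // x; apply: le_trans _ (fc x); rewrite normrM [_ ^+ k.+1]exprS mulrA.
  rewrite ler_wpM2r ?exprn_ge0 ?sqrtr_ge0// mulrC ler_wpM2l//.
  apply: le_trans (coord_le_enorm x l) _.
  rewrite -[leLHS]ger0_norm ?sqrtr_ge0// -sqrtr_sqr ler_wsqrtr//; lra.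
- exists (`|a| * c); first by rewrite mulr_ge0.
  by move=> x; rewrite normrM -!mulrA ler_wpM2l.
- exists (c + b); first by rewrite addr_ge0.
  move=> x; rewrite mulrDl; apply: le_trans (lerD (fc x) (gb x)).
  by rewrite -mulrDl ler_wpM2r ?exprn_ge0 ?sqrtr_ge0// ler_normD.
Qed.

Lemma symbol_smooth f : symbol 0 f -> smooth f.
Proof.
move=> f0 s; have fs : symbol (size s) (foldr partial f s).
  by elim: s => //= i s; exact: symbol_partial.
by split; [exact: symbol_continuous fs|move=> i x; exact: symbol_derivable fs].
Qed.

Lemma symbol_iter_partial k f i m : symbol k f -> symbol (m + k) (iter m (partial i) f).
Proof. by move=> fk; elim: m => //= m; exact: symbol_partial. Qed.

End Symbols.

(** * The function [rho] and the weight property *)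

Section Weights.
Context {R : realType} {n : nat}.
Implicit Types (v w : 'rV[R]_(2 * n)) (lambda : R).

Lemma symbol_partial_wl u k (f : 'rV[R]_(2 * n + 1) -> R) (alpha : 'I_(2 * n) -> nat) beta : bernstein u ->
  symbol u k f -> symbol u (\sum_(i < 2 * n) alpha i + beta + k) (partial_wl alpha beta f).
Proof.
move=> hu fk; rewrite /partial_wl -big_enum /=.
elim: (enum _) => [|i s IH] /=.
  by rewrite big_nil; exact: symbol_iter_partial.
by rewrite big_cons -!addnA; apply: symbol_iter_partial => //; rewrite addnA.
Qed.

Lemma enorm_pt w lambda : enorm (pt w lambda) ^+ 2 = enorm w ^+ 2 + `|lambda| ^+ 2.
Proof.
rewrite !enorm_sqr big_split_ord /= big_ord1; congr (_ + _).
  by apply: eq_bigr => i _; rewrite row_mxEl.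
by rewrite row_mxEr mxE eqxx mulr1n real_normK ?num_real.
Qed.

Lemma rhoE w lambda : rho w lambda = Num.sqrt (1 + enorm (pt w lambda) ^+ 2).
Proof. by rewrite enorm_pt addrA. Qed.

Lemma rho_sqr w lambda : rho w lambda ^+ 2 = 1 + enorm (pt w lambda) ^+ 2.
Proof. by rewrite rhoE sqr_sqrtr// ltW// one_enorm_gt0. Qed.

Lemma rho_ge1 w lambda : 1 <= rho w lambda.
Proof. by rewrite rhoE -[leLHS]sqrtr1 ler_wsqrtr// lerDl sqr_ge0. Qed.

Lemma norm_le_rho w lambda : `|lambda| <= rho w lambda.
Proof.
rewrite -[leLHS]ger0_norm// -sqrtr_sqr ler_wsqrtr// lerDr addr_ge0 ?sqr_ge0//.
Qed.

Lemma rho_triangle v w lambda : rho w lambda <= rho v lambda + enorm (v - w).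
Proof.
set D := enorm _; have D0 : 0 <= D by exact: sqrtr_ge0.
have v1 := rho_ge1 v lambda; have w1 := rho_ge1 w lambda.
set p := rho v lambda in v1 *; set q := rho w lambda in w1 *.
have vp : enorm v ^+ 2 <= p ^+ 2 by rewrite rho_sqr enorm_pt; have := sqr_ge0 `|lambda|; lra.
pose G := \sum_(i < 2 * n) v 0 i * (v - w) 0 i.
have qE : q ^+ 2 = p ^+ 2 - 2 * G + D ^+ 2.
  rewrite /p /q !rho_sqr !enorm_pt /D !enorm_sqr /G mulr_sumr.
  suff -> : \sum_(i < 2 * n) w 0 i ^+ 2 = \sum_(i < 2 * n) v 0 i ^+ 2 -
     \sum_(i < 2 * n) 2 * (v 0 i * (v - w) 0 i) + \sum_(i < 2 * n) (v - w) 0 i ^+ 2 by lra.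
  by rewrite -sumrB -big_split; apply: eq_bigr => i _ /=; rewrite !mxE; ring.
(* Cauchy-Schwarz combined with [|v| <= p], read off from the nonnegative sum of
   [(D v_i + p (v - w)_i)^2]. The final division by [2 p D] is why [D = 0] is treated apart. *)
have G0 : - G <= p * D.
  have [DE|Dn] := eqVneq D 0.
    rewrite DE mulr0 /G big1 ?oppr0// => i _.
    have : `|(v - w) 0 i| <= 0 by rewrite -DE; exact: coord_le_enorm.
    by rewrite normr_le0 => /eqP ->; rewrite mulr0.
  have Dp : 0 < D by rewrite lt_neqAle eq_sym Dn.
  have : 0 <= \sum_(i < 2 * n) (D * v 0 i + p * (v - w) 0 i) ^+ 2.
    by apply: sumr_ge0 => i _; exact: sqr_ge0.
  have -> : \sum_(i < 2 * n) (D * v 0 i + p * (v - w) 0 i) ^+ 2 =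
      D ^+ 2 * enorm v ^+ 2 + 2 * p * D * G + p ^+ 2 * D ^+ 2.
    rewrite (enorm_sqr _ v) [X in _ + p ^+ 2 * X](enorm_sqr _ (v - w)) /G !mulr_sumr -!big_split.
    by apply: eq_bigr => i _ /=; ring.
  have H : D ^+ 2 * enorm v ^+ 2 <= D ^+ 2 * p ^+ 2 by rewrite ler_wpM2l// sqr_ge0.
  move=> H2; have pD : 0 < 2 * p * D by rewrite !mulr_gt0//; lra.
  rewrite -(ler_pM2l pD); lra.
rewrite -(@ler_pXn2r _ 2) ?nnegrE//; [rewrite qE sqrrD mulr2n; lra|lra|lra].
Qed.

Lemma bernstein_weight u : bernstein u ->
  weight (fun w lambda => 1 + u (1 + enorm (pt w lambda) ^+ 2)).
Proof.
move=> hu; split.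
  by move=> w lambda; have := bernstein_ge0 u hu _ (one_enorm_gt0 (pt w lambda)); lra.
(* [8 = 2 * 2^2] is the bound of [bernstein_ratio] for [k = 2]: a distance of at most [p / 8] keeps
   [p] and [q] within a factor 2. The exponent 2 is that of [k] in the same bound. *)
exists 8, 2%N; split=> // v w lambda l0; rewrite -!rho_sqr invf_div.
have pq := rho_triangle v w lambda.
have qp := rho_triangle w v lambda; rewrite -enormN opprB in qp.
have p1 := rho_ge1 w lambda; have q1 := rho_ge1 v lambda.
have lp := norm_le_rho w lambda.
have D0 : 0 <= enorm (v - w) by exact: sqrtr_ge0.
have {}l0 : 0 < `|lambda| by rewrite normr_gt0.
set p := rho w lambda in pq qp p1 lp *; set q := rho v lambda in pq qp q1 *.
set D := enorm (v - w) in pq qp D0 *.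
have p0 : 0 < p by lra.
have q0 : 0 < q by lra.
split=> [HD|].
  have -> : 8 = 2 * 2 ^+ 2 :> R by rewrite expr2; ring.
  have {}HD : D <= p / 8 by rewrite mulrC.
  by split; apply: bernstein_ratio => //; lra.
(* Since [|lambda| <= p], the factor in front of [D] is at least 1. As [p, q >= 1], each of them is
   at most [1 + E] times the other. *)
set E := _ * D; have DE : D <= E.
  by rewrite /E ler_peMl// ler_pdivlMl// mulr1.
have HE : 2 * (1 + E) ^+ 2 <= 8 * (1 + E) ^+ 2 by rewrite ler_wpM2r ?sqr_ge0//; lra.
by split; apply: le_trans HE; apply: bernstein_ratio => //; nra.
Qed.

End Weights.

(** * Negative definiteness and admissibility *)

Lemma bernstein_negative_definite (R : realType) (d : nat) (u : R -> R) : bernstein u ->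
  negative_definite (fun xi : 'rV[R]_d => (u (1 + enorm xi ^+ 2))%:C).
Proof.
move=> hu; split => /=.
- exact: (symbol_continuous u hu 0 _ (symbol_deriv u 0)).
- exact: cst_continuous.
move=> t t0.
have -> : (fun xi : 'rV[R]_d => cexp (- (t%:C * (u (1 + enorm xi ^+ 2))%:C))) =
    (fun xi => (expR (- (t * u (1 + enorm xi ^+ 2))))%:C).
  by apply/funext => xi; rewrite -rmorphM -rmorphN cexp_real.
apply: positive_definite_real => [x|N x]; first by rewrite enormN.
apply: (psd_completely_monotone _ _ (fun s => expR (- (t * u s)))) => k.
exact/bernstein_exp_cmonotone/ltW.
Qed.

Theorem proposition5p10 (R : realType) (n : nat) (hn : (1 <= n)%N)
    (u : R -> R) (hu : bernstein u)
    (hgrowth : exists C : R, forall t : R, 0 < t -> u t <= C * Num.sqrt t) :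
  admissible (fun xi : 'rV[R]_(2 * n + 1) => (u (1 + enorm xi ^+ 2))%:C).
Proof.
have symbol_u := @symbol_deriv R (2 * n + 1) u 0.
split=> //=.
- exact: bernstein_negative_definite.
- split; first exact: bernstein_weight.
  have [C uC] := hgrowth; exists C => w lambda.
  by rewrite rhoE; apply: uC; exact: one_enorm_gt0.
split; first exact: (symbol_smooth u hu _ symbol_u).
move=> alpha beta.
(* The function is a symbol of order [2 * 0], so the derivative has order exactly [|alpha| + beta];
   the bound by [c u] is then weakened to [c (1 + u)]. *)
have [c c0 uc] := symbol_bound u hu _ _ (symbol_partial_wl u _ _ alpha beta hu symbol_u).
exists c => w lambda; have := uc (pt w lambda); rewrite -rhoE muln0 addn0.
have r0 : 0 < rho w lambda by exact: lt_le_trans (rho_ge1 _ _).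
rewrite ler_pdivlMr ?exprn_gt0// => /le_trans; apply.
by rewrite ler_wpM2l//; lra.
Qed.
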